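(* Let $K$ be a field and let $\Gamma$ be a finite subgroup of $\mathrm{PGL}_{N+1}(K)$. Then there are infinitely many morphisms $f:\mathbb{P}^N\to\mathbb{P}^N$ such that $\Gamma\subseteq\mathrm{Aut}(f)$.
   Context: A morphism $f:\mathbb{P}^N\to\mathbb{P}^N$ is given by an $(N+1)$-tuple of homogeneous polynomials of a common degree in $x_0,\dots,x_N$ with no common zero (over an algebraic closure), taken up to a common scalar. For such $f$, $\mathrm{Aut}(f)=\{\alpha\in\mathrm{PGL}_{N+1}:\alpha\circ f\circ\alpha^{-1}=f\}$. *)

(* Defs.v *)
From HB Require Import structures.
From mathcomp Require Import all_boot all_order all_algebra.
From mathcomp Require Import boolp classical_sets cardinality.
From mathcomp Require Import mpoly.

Set Implicit Arguments.
Unset Strict Implicit.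
Unset Printing Implicit Defensive.

Import GRing.Theory.
Local Open Scope quotient_scope.
Local Open Scope ring_scope.

Section ProjectiveLinearGroup.
Variables (K : fieldType) (n : nat).

Record GL := MkGL { GLmx :> 'M[K]_n; GLmxP : GLmx \in unitmx }.

HB.instance Definition _ := [isSub for GLmx].
HB.instance Definition _ := [Choice of GL by <:].

Lemma GL1_proof : (1%:M : 'M[K]_n) \in unitmx. Proof. exact: unitmx1. Qed.
Definition GL1 := MkGL GL1_proof.

Lemma GLM_proof (A B : GL) : A *m B \in unitmx.
Proof. by rewrite unitmx_mul !GLmxP. Qed.
Definition GLM A B := MkGL (GLM_proof A B).

Lemma GLV_proof (A : GL) : invmx A \in unitmx.
Proof. by rewrite unitmx_inv GLmxP. Qed.
Definition GLV A := MkGL (GLV_proof A).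

Definition GLscal_eq (A B : GL) := is_scalar_mx (A *m invmx B).

Lemma GLscal_eqP (A B : GL) :
  reflect (exists c : K, GLmx A = c *: GLmx B) (GLscal_eq A B).
Proof.
apply: (iffP is_scalar_mxP) => -[c e]; exists c.
  by rewrite -mul_scalar_mx -e mulmxKV // GLmxP.
by rewrite e -scalemxAl mulmxV ?GLmxP // scalemx1.
Qed.

Lemma GLscal_eq_refl : reflexive GLscal_eq.
Proof. by move=> A; apply/GLscal_eqP; exists 1; rewrite scale1r. Qed.

Lemma GLscal_eq_imp (A B : GL) : GLscal_eq A B -> GLscal_eq B A.
Proof.
move=> /GLscal_eqP[c e]; apply/GLscal_eqP; exists c^-1.
have [c0|c0] := eqVneq c 0; last by rewrite e scalerA mulVf // scale1r.
rewrite c0 scale0r in e.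
have := GLmxP A; rewrite e => u0.
have z : (1%:M : 'M[K]_n) = 0 by rewrite -(mulmxV u0) mul0mx.
by rewrite -[GLmx B]mul1mx z mul0mx scaler0.
Qed.

Lemma GLscal_eq_sym : ssrbool.symmetric GLscal_eq.
Proof. by move=> A B; apply/idP/idP; apply: GLscal_eq_imp. Qed.

Lemma GLscal_eq_trans : transitive GLscal_eq.
Proof.
move=> B A C /GLscal_eqP[c e] /GLscal_eqP[d f]; apply/GLscal_eqP.
by exists (c * d); rewrite e f scalerA.
Qed.

Canonical GLscal_equiv :=
  EquivRel GLscal_eq GLscal_eq_refl GLscal_eq_sym GLscal_eq_trans.

Definition PGL := {eq_quot GLscal_eq}.
HB.instance Definition _ := Choice.on PGL.
HB.instance Definition _ := EqQuotient.on PGL.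

Lemma eq_piPGL (A B : GL) : (\pi_PGL A = \pi_PGL B) <-> GLscal_eq A B.
Proof. by split=> [/eqmodP | h]; [|apply/eqmodP]. Qed.

Lemma GLscal_repr (A : GL) : GLscal_eq (repr (\pi_PGL A)) A.
Proof. by apply/eq_piPGL; rewrite reprK. Qed.

Definition PGL1 : PGL := \pi_PGL GL1.
Definition PGLM (a b : PGL) : PGL := \pi_PGL (GLM (repr a) (repr b)).
Definition PGLV (a : PGL) : PGL := \pi_PGL (GLV (repr a)).

Lemma PGLM_pi (A B : GL) : PGLM (\pi_PGL A) (\pi_PGL B) = \pi_PGL (GLM A B).
Proof.
apply/eq_piPGL; apply/GLscal_eqP => /=.
have /GLscal_eqP[c ->] := GLscal_repr A; have /GLscal_eqP[d ->] := GLscal_repr B.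
by exists (c * d); rewrite -scalemxAl -scalemxAr scalerA.
Qed.

Lemma PGLV_pi (A : GL) : PGLV (\pi_PGL A) = \pi_PGL (GLV A).
Proof.
apply/eq_piPGL; apply: GLscal_eq_imp; apply/GLscal_eqP => /=.
have /GLscal_eqP[c e] := GLscal_repr A; exists c.
set R := repr _ in e *.
have RA : R *m invmx A = c%:M.
  by rewrite e -scalemxAl mulmxV ?GLmxP // scalemx1.
by rewrite -[LHS]mul1mx -(mulVmx (GLmxP R)) -mulmxA RA mul_mx_scalar.
Qed.

Lemma PGL_mulA : associative PGLM.
Proof.
elim/quotW=> A; elim/quotW=> B; elim/quotW=> C.
rewrite (PGLM_pi B C) (PGLM_pi A B) !PGLM_pi.
by apply: (congr1 (fun X => \pi_PGL X)); apply: val_inj; rewrite /= mulmxA.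
Qed.

Lemma PGL_mul1 : left_id PGL1 PGLM.
Proof.
elim/quotW=> A; rewrite PGLM_pi.
by apply: (congr1 (fun X => \pi_PGL X)); apply: val_inj; rewrite /= mul1mx.
Qed.

Lemma PGL_mulr1 : right_id PGL1 PGLM.
Proof.
elim/quotW=> A; rewrite PGLM_pi.
by apply: (congr1 (fun X => \pi_PGL X)); apply: val_inj; rewrite /= mulmx1.
Qed.

Lemma PGL_mulV : left_inverse PGL1 PGLV PGLM.
Proof.
elim/quotW=> A; rewrite (PGLV_pi A) PGLM_pi.
by apply: (congr1 (fun X => \pi_PGL X)); apply: val_inj; rewrite /= mulVmx ?GLmxP.
Qed.

Lemma PGL_mulrV : right_inverse PGL1 PGLV PGLM.
Proof.
elim/quotW=> A; rewrite (PGLV_pi A) PGLM_pi.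
by apply: (congr1 (fun X => \pi_PGL X)); apply: val_inj; rewrite /= mulmxV ?GLmxP.
Qed.

HB.instance Definition _ :=
  isGroup.Build PGL PGL_mulA PGL_mul1 PGL_mulr1 PGL_mulV PGL_mulrV.

End ProjectiveLinearGroup.

Section BaseChange.
Variables (K L : fieldType) (iota : {rmorphism K -> L}) (n : nat).

Lemma GLmap_proof (A : GL K n) : map_mx iota A \in unitmx.
Proof. by rewrite map_unitmx GLmxP. Qed.
Definition GLmap (A : GL K n) : GL L n := MkGL (GLmap_proof A).

Definition PGLmap (a : PGL K n) : PGL L n := \pi_(PGL L n) (GLmap (repr a)).

Lemma PGLmap_pi (A : GL K n) :
  PGLmap (\pi_(PGL K n) A) = \pi_(PGL L n) (GLmap A).
Proof.
apply/eq_piPGL; apply/GLscal_eqP => /=.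
by have /GLscal_eqP[c ->] := GLscal_repr A; exists (iota c); rewrite map_mxZ.
Qed.

End BaseChange.

Arguments PGLmap {K L} iota {n} a.

Section Endomorphisms.
(* L is algebraically closed, so the zeros that have to be excluded are the
   L-points; the homogeneous coordinates of P^N are x_0, ..., x_N. *)
Variables (L : closedFieldType) (N : nat).
Local Notation n := N.+1.

Definition no_common_zero (F : n.-tuple {mpoly L[n]}) :=
  forall v : 'I_n -> L, (exists i, v i != 0) -> exists j, (tnth F j).@[v] != 0.

Definition is_morphism_tuple (F : n.-tuple {mpoly L[n]}) :=
  (exists d, forall i, tnth F i \is d.-homog) /\ no_common_zero F.

Record morphism_tuple := MkMorphismTuple {
  mtuple :> n.-tuple {mpoly L[n]};
  mtuple_asbool : `[< is_morphism_tuple mtuple >] }.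

HB.instance Definition _ := [isSub for mtuple].
HB.instance Definition _ := [Choice of morphism_tuple by <:].

Lemma mtupleP (F : morphism_tuple) : is_morphism_tuple F.
Proof. exact/asboolP/mtuple_asbool. Qed.

Definition tuple_scal (F G : n.-tuple {mpoly L[n]}) :=
  exists2 c : L, c != 0 & forall i, tnth F i = c *: tnth G i.

Definition mtuple_eq (F G : morphism_tuple) : bool := `[< tuple_scal F G >].

Lemma mtuple_eq_refl : reflexive mtuple_eq.
Proof.
by move=> F; apply/asboolP; exists 1; rewrite ?oner_eq0 // => i; rewrite scale1r.
Qed.

Lemma mtuple_eq_imp (F G : morphism_tuple) : mtuple_eq F G -> mtuple_eq G F.
Proof.
move=> /asboolP[c c0 e]; apply/asboolP; exists c^-1; rewrite ?invr_eq0 // => i.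
by rewrite e scalerA mulVf // scale1r.
Qed.

Lemma mtuple_eq_sym : ssrbool.symmetric mtuple_eq.
Proof. by move=> F G; apply/idP/idP; apply: mtuple_eq_imp. Qed.

Lemma mtuple_eq_trans : transitive mtuple_eq.
Proof.
move=> G F H /asboolP[c c0 e] /asboolP[d d0 f]; apply/asboolP.
by exists (c * d); rewrite ?mulf_neq0 // => i; rewrite e f scalerA.
Qed.

Canonical mtuple_equiv :=
  EquivRel mtuple_eq mtuple_eq_refl mtuple_eq_sym mtuple_eq_trans.

Definition projEnd := {eq_quot mtuple_eq}.
HB.instance Definition _ := Choice.on projEnd.
HB.instance Definition _ := EqQuotient.on projEnd.

Lemma eq_piEnd (F G : morphism_tuple) :
  (\pi_projEnd F = \pi_projEnd G) <-> tuple_scal F G.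
Proof.
split=> [/eqmodP/asboolP // | h]; apply/eqmodP; exact/asboolP.
Qed.

Lemma mtuple_repr (F : morphism_tuple) : tuple_scal (repr (\pi_projEnd F)) F.
Proof. by apply/eq_piEnd; rewrite reprK. Qed.

Definition tuple_comp (F G : n.-tuple {mpoly L[n]}) : n.-tuple {mpoly L[n]} :=
  [tuple tnth F i \mPo G | i < n].

Lemma dhomog_comp (d e : nat) (p : {mpoly L[n]}) (G : n.-tuple {mpoly L[n]}) :
  p \is d.-homog -> (forall i, tnth G i \is e.-homog) ->
  p \mPo G \is (e * d)%N.-homog.
Proof.
move=> hp hG; rewrite comp_mpolyE big_seq; apply: rpred_sum => m mp.
apply: rpredZ; rewrite -(dhomog_mf hp mp) /= mdegE big_distrr /=.
apply: (big_ind2 (fun (q : {mpoly L[n]}) k => q \is k.-homog)).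
- exact: dhomog1.
- by move=> q k q' k' hq hq'; apply: dhomogM.
- by move=> i _; apply: dhomogMn.
Qed.

Lemma tuple_comp_proof (F G : morphism_tuple) :
  `[< is_morphism_tuple (tuple_comp F G) >].
Proof.
have [[d hF] zF] := mtupleP F; have [[e hG] zG] := mtupleP G.
apply/asboolP; split.
  by exists (e * d)%N => i; rewrite tnth_mktuple; apply: dhomog_comp.
move=> v v0; have [j Fj] := zF _ (zG v v0); exists j.
by rewrite tnth_mktuple comp_mpoly_meval.
Qed.

Definition mtuple_comp (F G : morphism_tuple) :=
  MkMorphismTuple (tuple_comp_proof F G).

Definition End_comp (f g : projEnd) : projEnd :=
  \pi_projEnd (mtuple_comp (repr f) (repr g)).

Lemma comp_mpoly_scal (d : nat) (c : L) (p : {mpoly L[n]})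
    (G H : n.-tuple {mpoly L[n]}) :
  p \is d.-homog -> (forall i, tnth G i = c *: tnth H i) ->
  p \mPo G = c ^+ d *: (p \mPo H).
Proof.
move=> hp e; rewrite !comp_mpolyE scaler_sumr; apply: eq_big_seq => m mp.
rewrite scalerA mulrC -scalerA; congr (_ *: _).
under eq_bigr do rewrite e exprZn.
rewrite scaler_prod; congr (_ *: _).
by rewrite prodrXr -mdegE (dhomog_mf hp mp).
Qed.

Lemma End_comp_pi (F G : morphism_tuple) :
  End_comp (\pi_projEnd F) (\pi_projEnd G) = \pi_projEnd (mtuple_comp F G).
Proof.
apply/eq_piEnd.
have [c c0 eF] := mtuple_repr F; have [k k0 eG] := mtuple_repr G.
have [[d hF] _] := mtupleP F.
exists (c * k ^+ d) => [|i]; first by rewrite mulf_neq0 // expf_neq0.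
by rewrite !tnth_mktuple eF linearZ /= (comp_mpoly_scal (hF i) eG) scalerA.
Qed.

(* A matrix acts on the column vector of homogeneous coordinates. *)
Definition linear_tuple (A : 'M[L]_n) : n.-tuple {mpoly L[n]} :=
  [tuple \sum_j A i j *: 'X_j | i < n].

Lemma linear_tuple_proof (A : GL L n) :
  `[< is_morphism_tuple (linear_tuple A) >].
Proof.
apply/asboolP; split.
  exists 1%N => i; rewrite tnth_mktuple; apply: rpred_sum => j _.
  by apply: rpredZ; rewrite dhomogX /= mdeg1.
move=> v [i vi]; apply: contrapT => nz.
have Av0 : A *m (\col_j v j) = 0.
  apply/colP => j; rewrite !mxE; apply/eqP; apply: contrapT => Ajn0.
  apply: nz; exists j; rewrite tnth_mktuple raddf_sum /=; apply/negP => h0.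
  apply: Ajn0; apply/eqP; rewrite -[RHS](eqP h0); apply: eq_bigr => k _.
  by rewrite mevalZ mevalXU mxE.
have : (\col_j v j) = 0 :> 'cV[L]_n.
  by rewrite -[LHS]mul1mx -(mulVmx (GLmxP A)) -mulmxA Av0 mulmx0.
by move=> /colP/(_ i); rewrite !mxE => e; rewrite e eqxx in vi.
Qed.

Definition linear_mtuple (A : GL L n) := MkMorphismTuple (linear_tuple_proof A).

Definition End_of_PGL (a : PGL L n) : projEnd :=
  \pi_projEnd (linear_mtuple (repr a)).

Lemma End_of_PGL_pi (A : GL L n) :
  End_of_PGL (\pi_(PGL L n) A) = \pi_projEnd (linear_mtuple A).
Proof.
apply/eq_piEnd; have /GLscal_eqP[c e] := GLscal_repr A; exists c => [|i].
  apply/eqP => c0; rewrite c0 scale0r in e.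
  have := GLmxP (repr (\pi_(PGL L n) A)).
  by rewrite e unitmxE det0 unitr0.
rewrite !tnth_mktuple e scaler_sumr; apply: eq_bigr => j _.
by rewrite mxE scalerA.
Qed.

Local Open Scope classical_set_scope.

Definition projAut (f : projEnd) : set (PGL L n) :=
  [set a | End_comp (End_comp (End_of_PGL a) f) (End_of_PGL (a^-1)%g) = f].

End Endomorphisms.

(* Main.v *)
(** Lift [Gamma] to a finite group [G] of matrices over the algebraically closed
    field and look for a homogeneous [G]-equivariant map [F] of degree [d] whose
    only zero is the origin; [F] then commutes with [Gamma] on projective space.

    For a vector [v <> 0] let [W v] be the space of all [w] such that
    [w g = z w] whenever [g] is in [G] and [v g = z v]. For a suitable residue
    class of [d] modulo [#|G|] the equivariant maps of degree [d] take at [v]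
    every value in [W v]. Indeed an inhomogeneous equivariant interpolation on
    the orbit of [v] reaches every such value. To control the degrees of its
    homogeneous components, [G] is enlarged by the roots of unity of order the
    prime-to-p part [r] of [#|G|], which forces degrees congruent to [1] modulo
    [r], and everything is composed with the Frobenius map of exponent the p-part
    [q] of [#|G|], which forces degrees divisible by [q]. All these degrees agree
    modulo [q r = #|G|], and the norm of a linear form is an invariant of
    degree [#|G|] that makes up the difference. (Without the Frobenius twist the
    claim fails in the modular case.)

    Only finitely many spaces [W] occur. If [dim W = s], the [v] in [W] form a
    projective space of dimension [s - 1], while [F v = 0] imposes [s]
    independent linear conditions on the coefficients of [F]. So the maps that
    vanish at some [v] with [W v = W] lie in the image of a polynomial map in
    fewer variables than there are coefficients, hence in a hypersurface, and a
    generic [F] avoids all of these hypersurfaces. As [d] is unbounded, this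
    gives infinitely many morphisms. *)

From HB Require Import structures.
Require Import Defs.
From mathcomp Require Import all_boot all_order all_algebra.
From mathcomp Require Import boolp classical_sets cardinality.
From mathcomp Require Import cyclic separable cyclotomic.
From mathcomp Require mpoly.

(* [mpoly] is imported only inside this module: its notations break the parsing
   of [[in Gamma]] in the theorem. *)
Module Equivariants.

Import mpoly.

Set Implicit Arguments.
Unset Strict Implicit.
Unset Printing Implicit Defensive.

Import GRing.Theory.
Local Open Scope quotient_scope.
Local Open Scope ring_scope.

(** * Polynomial functions over an infinite field *)

Lemma digits_inj (D n : nat) (a b : 'I_n -> nat) :
  (forall i, a i < D)%N -> (forall i, b i < D)%N ->
  (\sum_(i < n) a i * D ^ i = \sum_(i < n) b i * D ^ i)%N -> a =1 b.
Proof.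
elim: n a b => [|n IHn] a b aD bD; first by move=> _ [].
rewrite !big_ord_recl /= !expn0 !muln1.
have tailE (c : 'I_n.+1 -> nat) :
    (\sum_(i < n) c (lift ord0 i) * D ^ bump 0 i
      = (\sum_(i < n) c (lift ord0 i) * D ^ i) * D)%N.
  by rewrite big_distrl /=; apply: eq_bigr => i _; rewrite /bump add1n expnSr mulnA.
rewrite !tailE => e.
have D0 : (0 < D)%N by apply: leq_trans (aD ord0).
have e0 : a ord0 = b ord0.
  by have /= := congr1 (modn^~ D) e; rewrite 2!(addnC _ (_ * D)%N) !modnMDl !modn_small.
move: e; rewrite e0 => /addnI/eqP; rewrite eqn_pmul2r // => /eqP e1.
have eS := IHn (fun i => a (lift ord0 i)) (fun i => b (lift ord0 i))
  (fun i => aD _) (fun i => bD _) e1.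
by move=> i; case: (unliftP ord0 i) => [j ->|-> //]; apply: eS.
Qed.

Section InfiniteField.
Variable L : closedFieldType.

(** The polynomial [p * 'X + 1] is not constant, hence has a root, and [p] cannot vanish there. *)
Lemma closed_poly_nonroot (p : {poly L}) : p != 0 -> exists x, p.[x] != 0.
Proof.
move=> p0; have [q1|q1] := boolP (size (p * 'X + 1) == 1%N); last first.
  have /closed_rootP[x] := q1; rewrite rootE !hornerE => e; exists x.
  by apply: contraTneq e => ->; rewrite mul0r add0r oner_eq0.
move: q1; rewrite size_polyDl size_mulX ?size_poly1 //; last by rewrite ltnS size_poly_gt0.
by rewrite eqSS size_poly_eq0 (negbTE p0).
Qed.

(** Kronecker substitution: with [D] above all exponents of [p], putting [x ^+ (D ^ i)] for the
    [i]-th variable sends distinct monomials to distinct powers of [x] by [digits_inj], which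
    reduces to one variable. *)
Lemma mpoly_nonroot (n : nat) (p : {mpoly L[n]}) :
  p != 0 -> exists x : 'rV[L]_n, p.@[x 0] != 0.
Proof.
move=> p0; set D := msize p.
pose h (m : 'X_{1..n}) := (\sum_(i < n) m i * D ^ i)%N.
pose q := \sum_(m <- msupp p) p@_m *: 'X^(h m) : {poly L}.
have [m0 m0p] : exists m0, m0 \in msupp p.
  by exists (mlead p); apply: mlead_supp.
have mD m i : m \in msupp p -> (m i < D)%N.
  move=> /msize_mdeg_lt; apply: leq_ltn_trans.
  by rewrite mdegE (bigD1 i) //= leq_addr.
have q0 : q != 0.
  apply/eqP => /(congr1 (fun r : {poly L} => r`_(h m0))) /eqP.
  rewrite coef0 /q coef_sum (bigD1_seq m0) //= coefZ coefXn eqxx mulr1.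
  rewrite big_seq_cond big1 ?addr0; first by rewrite mcoeff_eq0 m0p.
  move=> m /andP[mp mm0]; rewrite coefZ coefXn.
  have [e|_] := eqVneq (h m0) (h m); last by rewrite mulr0.
  case/eqP: mm0; apply/esym/mnmP; apply: (digits_inj _ _ e) => i; exact: mD.
have [x qx] := closed_poly_nonroot q0.
exists (\row_i x ^+ (D ^ i)); apply: contra_neq qx => e.
rewrite -[RHS]e /q horner_sum mevalE; apply: eq_bigr => m _.
rewrite hornerE hornerXn /h -prodrXr; congr (_ * _).
by apply: eq_bigr => i _; rewrite mxE -exprM mulnC.
Qed.

Lemma mpoly_ext (n : nat) (p q : {mpoly L[n]}) :
  (forall x : 'rV[L]_n, p.@[x 0] = q.@[x 0]) -> p = q.
Proof.
move=> e; apply/eqP; rewrite -subr_eq0; apply: contraT => /mpoly_nonroot[x].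
by rewrite mevalB e subrr eqxx.
Qed.

End InfiniteField.

Lemma msize_prod_le (L : fieldType) (n : nat) (I : Type) (r : seq I) (Q : pred I)
    (F : I -> {mpoly L[n]}) (b : I -> nat) :
  (forall i, Q i -> msize (F i) <= (b i).+1)%N ->
  (msize (\prod_(i <- r | Q i) F i) <= (\sum_(i <- r | Q i) b i).+1)%N.
Proof.
move=> Fb; apply: (big_ind2 (fun (p : {mpoly L[n]}) s => msize p <= s.+1)%N).
- by rewrite msize1.
- move=> p s q t ps qt.
  have [->|p0] := eqVneq p 0; first by rewrite mul0r msize0.
  have [->|q0] := eqVneq q 0; first by rewrite mulr0 msize0.
  by rewrite msizeM // -addSn -subn1 leq_subLR add1n -addnS leq_add.
- exact: Fb.
Qed.

Lemma msize_exp_le (L : fieldType) (n : nat) (p : {mpoly L[n]}) (b k : nat) :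
  (msize p <= b.+1)%N -> (msize (p ^+ k) <= (b * k).+1)%N.
Proof.
move=> pb; rewrite -[k in p ^+ k]subn0 -prodr_const_nat.
apply: leq_trans (msize_prod_le (b := fun=> b) _ _) _ => //.
by rewrite sum_nat_const_nat subn0 mulnC.
Qed.

Lemma mpoly_algdep (L : fieldType) (k m : nat) (P : 'I_m -> {mpoly L[k]}) :
  (k < m)%N ->
  exists2 A : {mpoly L[m]}, A != 0 &
    forall z : 'I_k -> L, A.@[fun i => (P i).@[z]] = 0.
Proof.
move=> km.
(* Dimension count: the [D ^ m] products of the [P i] with exponents below [D] have all their
   monomials in a box of [(c * D) ^ k] elements, and [D > c ^ k] makes the first number larger. *)
pose e := (\max_i msize (P i))%N; pose c := (m * e).+1; pose D := (c ^ k).+1.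
pose T := {ffun 'I_m -> 'I_D}; pose V := {ffun 'I_k -> 'I_(c * D)}.
pose mon (a : T) : 'X_{1..m} := [multinom (a i : nat) | i < m].
pose q (a : T) := \prod_(i < m) P i ^+ a i.
have qsize a : (msize (q a) <= c * D)%N.
  apply: leq_trans (msize_prod_le (b := fun i => (e * a i)%N) _ _) _.
    by move=> i _; apply: msize_exp_le; apply/leqW/leq_bigmax.
  have : (\sum_(i < m) e * a i <= \sum_(i < m) e * D)%N.
    by apply: leq_sum => i _; rewrite leq_mul2l ltnW ?orbT.
  rewrite sum_nat_const card_ord mulnA => h.
  by rewrite mulSn -add1n leq_add.
pose M := \matrix_(i < #|{: T}|, j < #|{: V}|)
  (q (enum_val i))@_[multinom (enum_val j l : nat) | l < k].
have ker0 : kermx M != 0.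
  rewrite -mxrank_eq0 mxrank_ker subn_eq0 -ltnNge.
  apply: leq_ltn_trans (rank_leq_col _) _.
  rewrite !card_ffun !card_ord expnMn -(subnKC km) expnD expnSr -mulnA mulnC.
  rewrite ltn_pmul2l ?expn_gt0 //.
  by rewrite (leq_trans (ltnSn (c ^ k))) // leq_pmulr // expn_gt0.
have [u u0 uM] : exists2 u : 'rV_#|{: T}|, u != 0 & u *m M = 0.
  have /rowV0Pn[u uk u0] := ker0; exists u => //; exact/sub_kermxP.
have mon_inj : injective mon.
  move=> a b /mnmP e'; apply/ffunP => i; apply: val_inj.
  by have := e' i; rewrite !mnmE.
exists (\sum_i u 0 i *: 'X_[mon (enum_val i)]).
  have [i ui] : exists i, u 0 i != 0.
    apply/existsP; apply: contraNT u0 => /existsPn h; apply/eqP/rowP => i.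
    by have := h i; rewrite negbK mxE => /eqP.
  apply: contraNneq ui => /(congr1 (mcoeff (mon (enum_val i)))).
  rewrite mcoeff0 raddf_sum (bigD1 i) //= mcoeffZ mcoeffX eqxx mulr1.
  rewrite big1 ?addr0 => [-> //|j ji]; rewrite mcoeffZ mcoeffX.
  by rewrite (inj_eq mon_inj) (inj_eq enum_val_inj) (negbTE ji) mulr0.
move=> z; rewrite raddf_sum /=.
transitivity ((\sum_i u 0 i *: q (enum_val i)).@[z]).
  rewrite [RHS]raddf_sum; apply: eq_bigr => i _ /=; rewrite !mevalZ mevalX.
  congr (_ * _); rewrite rmorph_prod; apply: eq_bigr => l _.
  by rewrite mnmE rmorphXn.
suff -> : \sum_i u 0 i *: q (enum_val i) = 0 by rewrite meval0.
apply/mpolyP => b; rewrite mcoeff0 raddf_sum /=.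
have [bs|bs] := boolP [forall l, b l < c * D]%N.
  pose v : V := [ffun l => Ordinal (forallP bs l)].
  have /rowP/(_ (enum_rank v)) := uM; rewrite !mxE => {2}<-.
  apply: eq_bigr => i _; rewrite mcoeffZ mxE enum_rankK; congr (_ * _).
  by congr (_@__); apply/mnmP => l; rewrite mnmE ffunE.
apply: big1 => i _; rewrite mcoeffZ; have [l bl] := forallPn bs.
suff /memN_msupp_eq0-> : b \notin msupp (q (enum_val i)) by rewrite mulr0.
apply: msize_mdeg_ge; apply: leq_trans (qsize _) _.
by rewrite -leqNgt in bl; apply: leq_trans bl _; rewrite mdegE (bigD1 l) //= leq_addr.
Qed.

(** * Generic members of a linear family *)

Section Avoidance.
Variables (L : closedFieldType) (n m d : nat).
Variable F : 'I_m -> 'I_n -> {mpoly L[n]}.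
Hypothesis F_homog : forall i j, F i j \is d.-homog.

Lemma meval_homogZ (p : {mpoly L[n]}) (c : L) (v : 'rV[L]_n) e :
  p \is e.-homog -> p.@[(c *: v) 0] = c ^+ e * p.@[v 0].
Proof.
move=> hp; rewrite !mevalE mulr_sumr; apply: eq_big_seq => b bp.
rewrite mulrCA; congr (_ * _).
under eq_bigr do rewrite mxE exprMn.
by rewrite big_split /= prodrXr -mdegE (dhomog_mf hp bp).
Qed.

(** The product [t *m eval_family v] is the value at [v] of the combination with coefficients [t];
    the row space is the set of all such values. *)
Definition eval_family (v : 'rV[L]_n) : 'M[L]_(m, n) :=
  \matrix_(i, j) (F i j).@[v 0].

Lemma eval_familyZ c v : eval_family (c *: v) = c ^+ d *: eval_family v.
Proof. by apply/matrixP => i j; rewrite !mxE (meval_homogZ _ _ (F_homog i j)). Qed.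

(* Solving [t *m eval_family v *m J = 0] for the pivot coordinates of [t] by
   Cramer's rule, with [v] normalised by [y 0 j = 1], exhibits the bad [t] as
   values of a polynomial map in [m.-1] variables: the coordinate [f j] of the
   parameter is not needed. *)
Lemma avoid_pivot (s : nat) (B : 'M[L]_(s, n)) (J : 'M[L]_(n, s))
    (f : {ffun 'I_s -> 'I_m}) (j : 'I_s) :
  exists2 A : {mpoly L[m]}, A != 0 &
    forall (t : 'rV[L]_m) (y : 'rV[L]_s), injective f -> y 0 j = 1 ->
      rowsub f (eval_family (y *m B) *m J) \in unitmx ->
      t *m eval_family (y *m B) = 0 -> A.@[t 0] = 0.
Proof.
pose zz (i : 'I_m) : {mpoly L[m.-1]} :=
  if unlift (f j) i is Some l then 'X_l else 1.
pose vp := (\row_a zz (f a)) *m map_mx (@mpolyC m.-1 L) B.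
pose Xp := \matrix_(i, l) (F i l \mPo [tuple vp 0 l' | l' < n]).
pose Yp := Xp *m map_mx (@mpolyC m.-1 L) J.
pose maskp := \row_i (if i \in codom f then 0 else zz i).
pose Up := rowsub f Yp.
(* The parameters carry [y] at the pivots and [t] divided by the determinant elsewhere. This
   division clears the denominator in Cramer's rule, so [Pp] evaluates to [t]. *)
pose Pp := - (maskp *m Yp *m \adj Up *m rowsub f 1%:M) + \det Up *: maskp.
have [|A A0 hA] := @mpoly_algdep L m.-1 m (Pp 0).
  by rewrite ltn_predL; apply: leq_ltn_trans (ltn_ord (f j)).
exists A => // t y f_inj yj; set v := y *m B; set Y := _ *m J => Yu tX0.
pose tmask : 'rV_m := \row_i (if i \in codom f then 0 else t 0 i).
pose S : 'M[L]_(s, m) := rowsub f 1%:M.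
have Sf (u : 'rV_s) a : (u *m S) 0 (f a) = u 0 a.
  rewrite mxE (bigD1 a) //= !mxE eqxx mulr1 big1 ?addr0 // => b ba.
  by rewrite !mxE (inj_eq f_inj) (negbTE ba) mulr0.
have SN (u : 'rV_s) i : i \notin codom f -> (u *m S) 0 i = 0.
  move=> iN; rewrite mxE big1 // => b _; rewrite !mxE.
  by case: eqP iN => [<-|]; rewrite ?codom_f ?mulr0.
pose U := rowsub f Y; pose dU := \det U.
have dU0 : dU != 0 by rewrite -unitfE -unitmxE.
pose zh : 'rV_m := y *m S + dU^-1 *: tmask.
pose z l := zh 0 (lift (f j) l).
have zhf a : zh 0 (f a) = y 0 a by rewrite /zh mxE Sf !mxE codom_f mulr0 addr0.
have zhN i : i \notin codom f -> zh 0 i = dU^-1 * t 0 i.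
  by move=> iN; rewrite /zh mxE SN // !mxE (negbTE iN) add0r.
have zzE i : (zz i).@[z] = zh 0 i.
  rewrite /zz; case: unliftP => [l ->|->]; first by rewrite mevalXU.
  by rewrite meval1 zhf yj.
have CE a b (M : 'M[L]_(a, b)) : map_mx (meval z) (map_mx (@mpolyC m.-1 L) M) = M.
  by apply/matrixP => i l; rewrite !mxE mevalC.
have vpE : map_mx (meval z) vp = v.
  rewrite /vp map_mxM CE; congr (_ *m _); apply/rowP => a.
  by rewrite !mxE /= zzE zhf.
have XpE : map_mx (meval z) Xp = eval_family v.
  apply/matrixP => i l; rewrite !mxE comp_mpoly_meval; apply: meval_eq => l'.
  by rewrite tnth_mktuple -vpE [RHS]mxE.
have YpE : map_mx (meval z) Yp = Y by rewrite map_mxM CE XpE.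
have UpE : map_mx (meval z) Up = U.
  by rewrite /U -YpE; apply/matrixP => a b; rewrite !mxE.
have maskE : map_mx (meval z) maskp = dU^-1 *: tmask.
  apply/rowP => i; rewrite !mxE; case: ifPn => ci; first by rewrite meval0 mulr0.
  by rewrite zzE zhN.
have SE : map_mx (meval z) (rowsub f 1%:M : 'M_(s, m)) = S.
  by apply/matrixP => a b; rewrite !mxE rmorph_nat.
have tf : t = (\row_a t 0 (f a)) *m S + tmask.
  apply/rowP => i; rewrite mxE; have [/codomP[a ->]|iN] := boolP (i \in codom f).
    by rewrite Sf !mxE codom_f addr0.
  by rewrite SN // !mxE (negbTE iN) add0r.
have key : (\row_a t 0 (f a)) *m U = - (tmask *m Y).
  apply/eqP; rewrite -addr_eq0 /U rowsubE mulmxA -mulmxDl -tf.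
  by rewrite /Y mulmxA tX0 mul0mx.
have PpE : map_mx (meval z) Pp = t.
  rewrite /Pp map_mxD map_mxN map_mxZ -det_map_mx 3!map_mxM map_mx_adj.
  rewrite UpE maskE YpE SE scalerA divff // scale1r [RHS]tf; congr (_ + _).
  rewrite -mulNmx; congr (_ *m _).
  rewrite -!scalemxAl -scalerN -mulNmx -key.
  by rewrite -mulmxA mul_mx_adj mul_mx_scalar scalerA mulVf // scale1r.
rewrite -(hA z); apply: meval_eq => i.
by rewrite -[in LHS]PpE mxE.
Qed.

(** Since the values at [v] span [W], some choice [f] of pivot rows is invertible; some coordinate
    [j] of [v] in the basis [B] is nonzero. The pairs [(f, j)] are finite in number, so the product
    of their polynomials from [avoid_pivot] works. *)
Lemma avoid_subspace (W : 'M[L]_n) :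
  exists2 A : {mpoly L[m]}, A != 0 &
    forall (t : 'rV[L]_m) (v : 'rV[L]_n), v != 0 -> (v <= W)%MS ->
      (W <= eval_family v)%MS -> t *m eval_family v = 0 -> A.@[t 0] = 0.
Proof.
pose B := row_base W; pose J := pinvmx B; pose s : nat := \rank W.
have BJ : B *m J = 1%:M by apply/mulmxVp/row_base_free.
pose Q (p : {ffun 'I_s -> 'I_m} * 'I_s) := avoid_pivot B J p.1 p.2.
exists (\prod_p s2val (cid2 (Q p))).
  by apply/prodf_neq0 => p _; case: cid2.
move=> t v v0 vW WX tX0.
have /submxP[y vE] : (v <= B)%MS by rewrite eq_row_base.
have [j yj] : exists j, y 0 j != 0.
  apply/existsP; apply: contraNT v0 => /existsPn h; rewrite vE.
  suff -> : y = 0 by rewrite mul0mx.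
  by apply/rowP => i; have := h i; rewrite negbK mxE => /eqP.
pose y1 := (y 0 j)^-1 *: y.
have c0 : (y 0 j)^-1 ^+ d != 0 by rewrite expf_neq0 ?invr_eq0.
have XE : eval_family (y1 *m B) = (y 0 j)^-1 ^+ d *: eval_family v.
  by rewrite /y1 -scalemxAl -vE eval_familyZ.
have full : row_full (eval_family (y1 *m B) *m J).
  have /submxP[C CE] : (B <= eval_family (y1 *m B))%MS.
    by rewrite eq_row_base XE (eqmx_scale _ c0).
  by apply/row_fullP; exists C; rewrite mulmxA -CE.
pose p := (fullrankfun full, j).
rewrite rmorph_prod (bigD1 p) //=; case: cid2 => A /= _ hA.
rewrite (hA t y1) ?mul0r //.
- exact: fullrankfun_inj.
- by rewrite mxE mulVf.
- exact: fullrowsub_unit.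
- by rewrite XE -scalemxAr tX0 scaler0.
Qed.

Lemma generic_member (Ws : seq 'M[L]_n) :
  (forall v, v != 0 -> exists2 W, W \in Ws & (v <= W <= eval_family v)%MS) ->
  exists t : 'rV[L]_m, forall v, v != 0 -> t *m eval_family v != 0.
Proof.
move=> cover; pose A W := s2val (cid2 (avoid_subspace W)).
have A0 : \prod_(W <- Ws) A W != 0.
  by rewrite prodf_seq_neq0; apply/allP => W _; rewrite /A; case: cid2.
have [t At] := mpoly_nonroot A0; exists t => v v0.
apply: contraNneq At => tX0; have [W Ws_W /andP[vW WX]] := cover v v0.
rewrite rmorph_prod /= prodf_seq_eq0; apply/hasP; exists W => //=.
by rewrite /A; case: cid2 => B /= _ hB; rewrite (hB t v).
Qed.

End Avoidance.

(** * Equivariant interpolation *)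

Section MatrixGroups.
Variables (L : closedFieldType) (n : nat).
Implicit Types (G : seq 'M[L]_n) (v w x u : 'rV[L]_n).

Definition mxgroup G :=
  [/\ uniq G, 1%:M \in G, {in G, forall g, g \in unitmx}
    & {in G &, forall g h, g *m h \in G}].

Lemma mxgroup_mull G k : mxgroup G -> k \in G ->
  perm_eq [seq k *m g | g <- G] G.
Proof.
move=> [uG _ unitG mulG] kG.
have inj : injective (mulmx k : 'M_n -> 'M_n) by apply/can_inj/mulKmx/unitG.
apply: uniq_perm => //; first by rewrite map_inj_uniq.
apply: (uniq_min_size _ _ _).2; rewrite ?map_inj_uniq ?size_map //.
by move=> _ /mapP[g gG ->]; apply: mulG.
Qed.

Lemma mxgroup_inv G g : mxgroup G -> g \in G -> invmx g \in G.
Proof.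
move=> GG gG; have [_ G1 unitG _] := GG.
have := G1; rewrite -(perm_mem (mxgroup_mull GG gG)) => /mapP[h hG e].
by rewrite -[invmx g]mulmx1 e mulKmx ?unitG.
Qed.

Definition eval_tuple (F : 'I_n -> {mpoly L[n]}) x : 'rV[L]_n :=
  \row_j (F j).@[x 0].

End MatrixGroups.

Lemma msize_sum_le (L : fieldType) (n : nat) (I : Type) (r : seq I) (Q : pred I)
    (F : I -> {mpoly L[n]}) (b : nat) :
  (forall i, Q i -> msize (F i) <= b)%N -> (msize (\sum_(i <- r | Q i) F i) <= b)%N.
Proof.
move=> Fb; apply: (big_ind (fun p : {mpoly L[n]} => msize p <= b)%N) => //.
  by rewrite msize0.
by move=> p q pb qb; apply: leq_trans (msizeD_le _ _) _; rewrite geq_max pb.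
Qed.

Section Interpolation.
Variables (L : closedFieldType) (n : nat) (G : seq 'M[L]_n).
Variables (s : {rmorphism L -> L}) (v w : 'rV[L]_n).
Hypothesis GG : mxgroup G.
Hypothesis stab : {in G, forall g, v *m g = v -> w *m g = w}.
Implicit Types (x u y : 'rV[L]_n).

Let orbit := undup [seq v *m g | g <- G].

(* On the orbit, twisted by [s], the product of the functions [sep u] for
   [u != v] is the indicator function of [v]. *)
Let sep u y : L :=
  if [pick i | u 0 i != v 0 i] is Some i
  then (s (v 0 i) - s (u 0 i))^-1 * (y 0 i - s (u 0 i)) else 1.

Let sepp u (g : 'M[L]_n) : {mpoly L[n]} :=
  if [pick i | u 0 i != v 0 i] is Some i
  then (s (v 0 i) - s (u 0 i))^-1 *: (\sum_j s (g j i) *: 'X_j - (s (u 0 i))%:MP)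
  else 1.

Let seppE u g x : (sepp u g).@[x 0] = sep u (x *m map_mx s g).
Proof.
rewrite /sepp /sep; case: pickP => [i _|_]; last by rewrite meval1.
rewrite mevalZ mevalB mevalC raddf_sum mxE /=; congr (_ * (_ - _)).
by apply: eq_bigr => j _; rewrite mevalZ mevalXU mxE mulrC.
Qed.

Let sepp_size u g : (msize (sepp u g) <= 2)%N.
Proof.
rewrite /sepp; case: pickP => [i _|_]; last by rewrite msize1.
apply: leq_trans (msizeZ_le _ _) _; apply: leq_trans (msizeD_le _ _) _.
rewrite geq_max msizeN msizeC (leq_trans (leq_b1 _)) // andbT.
apply: msize_sum_le => j _; apply: leq_trans (msizeZ_le _ _) _.
by rewrite msizeX mdeg1.
Qed.

Let sep_v u : sep u (map_mx s v) = 1.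
Proof.
rewrite /sep; case: pickP => // i ui.
by rewrite mxE mulVf // subr_eq0 fmorph_eq eq_sym.
Qed.

Let sep_u u : u != v -> sep u (map_mx s u) = 0.
Proof.
move=> uv; rewrite /sep; case: pickP => [i _|e]; first by rewrite mxE subrr mulr0.
by case/eqP: uv; apply/rowP => i; have := e i => /negbFE/eqP.
Qed.

(** Taking all [g] that carry [u] to [v], instead of choosing one, makes the value of [Q (u *m k)]
    at [x *m map_mx s k] equal to that of [Q u] at [x] for [k] in [G]. *)
Let Q u : {mpoly L[n]} :=
  \prod_(g <- G | u *m g == v) \prod_(u' <- orbit | u' != v) sepp u' g.

Let ind y := \prod_(u' <- orbit | u' != v) sep u' y.

Let QE u x : (Q u).@[x 0] = \prod_(g <- G | u *m g == v) ind (x *m map_mx s g).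
Proof.
rewrite rmorph_prod; apply: eq_bigr => g _.
by rewrite rmorph_prod; apply: eq_bigr => u' _; rewrite /= seppE.
Qed.

(** The value prescribed at the orbit point [u]; by [stab] it does not depend on which [g] carries
    [v] to [u]. *)
Let wt u := w *m nth 1%:M G (find (fun g => v *m g == u) G).

Let wtE g : g \in G -> wt (v *m g) = w *m g.
Proof.
move=> gG; rewrite /wt; set h := nth _ _ _.
have hasg : has (fun h => v *m h == v *m g) G by apply/hasP; exists g.
have vh : v *m h = v *m g by apply/eqP; apply: (nth_find 1%:M hasg).
have hG : h \in G by rewrite mem_nth // -has_find.
have [_ _ unitG mulG] := GG.
have := @stab (h *m invmx g); rewrite mulG ?mxgroup_inv // => /(_ isT).
rewrite !mulmxA vh mulmxK ?unitG // => /(_ erefl) e.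
by rewrite -{2}e mulmxKV ?unitG.
Qed.

Let orbitP u : reflect (exists2 g, g \in G & u = v *m g) (u \in orbit).
Proof. by rewrite mem_undup; apply: mapP. Qed.

Let orbit_perm k : k \in G -> perm_eq [seq u *m k | u <- orbit] orbit.
Proof.
move=> kG; have [_ _ unitG mulG] := GG.
have inj : injective (mulmx^~ k : 'rV_n -> 'rV_n) by apply/can_inj/mulmxK/unitG.
apply: uniq_perm; rewrite ?undup_uniq ?map_inj_uniq ?undup_uniq //.
apply: (uniq_min_size _ _ _).2; rewrite ?map_inj_uniq ?undup_uniq ?size_map //.
move=> _ /mapP[_ /orbitP[g gG ->] ->]; apply/orbitP.
by exists (g *m k); rewrite ?mulmxA ?mulG.
Qed.

Lemma equivariant_interpolation :
  exists F : 'I_n -> {mpoly L[n]},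
  [/\ forall j, (msize (F j) <= (size G ^ 2).+1)%N,
      {in G, forall k, forall x,
        eval_tuple F (x *m map_mx s k) = eval_tuple F x *m k}
    & eval_tuple F (map_mx s v) = w].
Proof.
have [uG G1 unitG mulG] := GG.
pose F j := \sum_(u <- orbit) (wt u) 0 j *: Q u.
have FE x : eval_tuple F x = \sum_(u <- orbit) (Q u).@[x 0] *: wt u.
  apply/rowP => j; rewrite mxE summxE raddf_sum; apply: eq_bigr => u _.
  by rewrite /= mevalZ [RHS]mxE mulrC.
exists F; split.
- move=> j; apply: msize_sum_le => u _; apply: leq_trans (msizeZ_le _ _) _.
  apply: leq_trans (msize_prod_le (b := fun=> size orbit) _ _) _ => [g _|].
    apply: leq_trans (msize_prod_le (b := fun=> 1%N) _ _) _ => [u' _|] //.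
    by rewrite ltnS sum1_count count_size.
  rewrite ltnS big_const_seq iter_addn_0 mulnC.
  rewrite leq_mul ?count_size //.
  by apply: leq_trans (size_undup _) _; rewrite size_map.
- move=> k kG x; rewrite !FE -(perm_big _ (orbit_perm kG)) big_map mulmx_suml.
  rewrite big_seq [RHS]big_seq; apply: eq_bigr => u /orbitP[h hG uE].
  rewrite -scalemxAl; congr (_ *: _); last first.
    by rewrite uE -mulmxA !wtE ?mulG // mulmxA.
  rewrite !QE -[RHS](perm_big _ (mxgroup_mull GG kG)) big_map.
  by apply: eq_big => g; rewrite ?mulmxA // map_mxM mulmxA.
- rewrite FE (bigD1_seq v) ?undup_uniq //=; last first.
    by apply/orbitP; exists 1%:M; rewrite ?mulmx1.
  rewrite big_seq_cond big1 ?addr0 => [|u /andP[/orbitP[g gG uE] uv]].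
    rewrite QE big1 => [|g /eqP vg].
      by rewrite scale1r -[in wt v](mulmx1 v) wtE // mulmx1.
    by rewrite -map_mxM vg /ind big1.
  rewrite QE; suff -> : \prod_(h <- G | u *m h == v) ind (map_mx s v *m map_mx s h) = 0.
    by rewrite scale0r.
  (* This [h] carries [u] to [v] and moves [v], so its factor contains [sep (v *m h)] at the twist
     of [v *m h], which is zero. *)
  have hG := mxgroup_inv GG gG; set h := invmx g in hG.
  have uh : u *m h = v by rewrite uE mulmxK // unitG.
  apply/eqP; rewrite prodf_seq_eq0; apply/hasP; exists h; rewrite ?uh ?eqxx //=.
  have vh : v *m h != v.
    by apply: contra_neq uv => vh; rewrite -(mulmxK (unitG _ hG) u) uh -{1}vh mulmxK ?unitG.
  rewrite -map_mxM prodf_seq_eq0; apply/hasP; exists (v *m h).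
    by apply/orbitP; exists h.
  by rewrite vh /= sep_u.
Qed.

End Interpolation.

(** * Invariants and homogeneous components *)

Section LinearForms.
Variables (L : closedFieldType) (n : nat).
Implicit Types (a c : 'I_n -> L) (x v : 'rV[L]_n).

Definition linear_form a : {mpoly L[n]} := \sum_j a j *: 'X_j.

Lemma linear_formE a x : (linear_form a).@[x 0] = \sum_j a j * x 0 j.
Proof. by rewrite raddf_sum; apply: eq_bigr => j _; rewrite /= mevalZ mevalXU. Qed.

Lemma linear_form_homog a : linear_form a \is 1.-homog.
Proof. by apply: rpred_sum => j _; apply: rpredZ; rewrite dhomogX /= mdeg1. Qed.

Lemma linear_form_neq0 v : v != 0 -> linear_form (v 0) != 0.
Proof.
apply: contra_neq => e; apply/rowP => j; have := congr1 (mcoeff U_(j)) e.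
rewrite mcoeff0 raddf_sum (bigD1 j) //= mcoeffZ mcoeffX eqxx mulr1 mxE.
rewrite big1 ?addr0 // => i ij; rewrite mcoeffZ mcoeffX.
case: eqP => [/mnmP/(_ i)|_]; last by rewrite mulr0.
by rewrite !mnm1E eqxx eq_sym (negbTE ij).
Qed.

Lemma dhomog_prod_seq (I : Type) (r : seq I) (F : I -> {mpoly L[n]}) (e : nat) :
  (forall i, F i \is e.-homog) -> \prod_(i <- r) F i \is (e * size r)%N.-homog.
Proof.
move=> hF; elim: r => [|i r IHr]; first by rewrite big_nil muln0; apply: dhomog1.
by rewrite big_cons mulnS; apply: dhomogM.
Qed.

(* The norm of a linear form that vanishes nowhere on the orbit of [v]. *)
Lemma invariant_nonzero_at (G : seq 'M[L]_n) v : mxgroup G -> v != 0 ->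
  exists I : {mpoly L[n]}, [/\ I \is (size G).-homog,
    {in G, forall g, forall x, I.@[(x *m g) 0] = I.@[x 0]} & I.@[v 0] != 0].
Proof.
move=> GG v0; have [_ _ unitG _] := GG.
(* Points and coefficients exchange roles: a non-root [c] of this product is the coefficient vector
   of a linear form nonzero on the whole orbit of [v]. *)
have R0 : \prod_(g <- G) (if g \in G then linear_form ((v *m g) 0) else 1) != 0.
  rewrite prodf_seq_neq0; apply/allP => g gG; rewrite gG /=.
  apply: linear_form_neq0; apply: contra_neq v0 => vg0.
  by rewrite -(mulmxK (unitG _ gG) v) vg0 mul0mx.
have [c cR] := mpoly_nonroot R0.
pose I : {mpoly L[n]} := \prod_(g <- G) linear_form ((c *m g^T) 0).
have IE x : I.@[x 0] = \prod_(g <- G) (x *m g *m c^T) 0 0.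
  rewrite rmorph_prod; apply: eq_bigr => g _ /=; rewrite linear_formE.
  rewrite -[x *m g *m _]mulmxA -[g]trmxK -trmx_mul trmxK mxE.
  by apply: eq_bigr => j _; rewrite [in RHS]mxE mulrC.
exists I; split.
- by rewrite -[size G]mul1n; apply: dhomog_prod_seq => g; apply: linear_form_homog.
- move=> g gG x; rewrite !IE -[RHS](perm_big _ (mxgroup_mull GG gG)) big_map.
  by apply: eq_bigr => h _; rewrite !mulmxA.
- rewrite IE; suff -> : \prod_(g <- G) (v *m g *m c^T) 0 0 =
    (\prod_(g <- G) (if g \in G then linear_form ((v *m g) 0) else 1)).@[c 0] by [].
  rewrite rmorph_prod; apply: eq_big_seq => g gG /=; rewrite gG linear_formE mxE.
  by apply: eq_bigr => j _; rewrite [X in _ * X]mxE.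
Qed.

End LinearForms.

Section HomogeneousComponents.
Variable L : closedFieldType.

Lemma closed_prim_root (r : nat) : r%:R != 0 :> L -> exists z : L, r.-primitive_root z.
Proof.
move=> r0; have rgt0 : (0 < r)%N by case: r r0 => //; rewrite eqxx.
have [rs] := closed_field_poly_normal ('X^r - 1 : {poly L}).
rewrite (monicP (monic_Xn_sub_1 _ rgt0)) scale1r => rsE.
have : has r.-primitive_root rs.
  apply: has_prim_root => //.
  - by apply/allP => z zrs; rewrite /root_of_unity rsE root_prod_XsubC.
  - by rewrite -separable_prod_XsubC -rsE separable_Xn_sub_1.
  - have := congr1 (fun p : {poly L} => size p) rsE.
    by rewrite size_Xn_sub_1 // size_prod_XsubC => -[->].
by move=> /hasP[z _ zr]; exists z.
Qed.

Lemma power_sum_eq0 (D : nat) (a : 'I_D -> L) :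
  (forall c, \sum_(e < D) c ^+ e * a e = 0) -> forall e, a e = 0.
Proof.
move=> a0 e; pose p := \poly_(i < D) (if insub i is Some j then a j else 0).
have : p = 0.
  apply/eqP; apply: contraT => /closed_poly_nonroot[c].
  rewrite horner_poly (eq_bigr (fun e : 'I_D => c ^+ e * a e)) ?a0 ?eqxx //.
  by move=> i _; rewrite valK mulrC.
by move=> /(congr1 (fun p : {poly L} => p`_e)); rewrite coef_poly ltn_ord valK coef0.
Qed.

Variables (n : nat).
Implicit Types (x : 'rV[L]_n) (F : 'I_n -> {mpoly L[n]}).

Definition homog_part e F j := pihomog mdeg e (F j).

Lemma homog_part_sum D F : (forall j, msize (F j) <= D)%N ->
  forall x, eval_tuple F x = \sum_(e < D) eval_tuple (homog_part e F) x.
Proof.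
move=> FD x; apply/rowP => j; rewrite summxE mxE {1}(pihomog_partitionE (FD j)).
by rewrite raddf_sum; apply: eq_bigr => e _; rewrite mxE.
Qed.

Lemma eval_homog_partZ e F c x :
  eval_tuple (homog_part e F) (c *: x) = c ^+ e *: eval_tuple (homog_part e F) x.
Proof.
by apply/rowP => j; rewrite !mxE (meval_homogZ _ _ (pihomogP _ _ _)).
Qed.

(** Putting [c *: x] for [x] gives a polynomial identity in [c], whose coefficients are compared. In
    the application [A] is the Frobenius twist of [B]. *)
Lemma homog_part_equivariant D F (A B : 'M[L]_n) :
  (forall j, msize (F j) <= D)%N ->
  (forall x, eval_tuple F (x *m A) = eval_tuple F x *m B) ->
  forall (e : 'I_D) x,
    eval_tuple (homog_part e F) (x *m A) = eval_tuple (homog_part e F) x *m B.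
Proof.
move=> FD FAB e x; apply/rowP => j; apply/eqP; rewrite -subr_eq0.
pose a (e : 'I_D) := eval_tuple (homog_part e F) (x *m A) 0 j
  - (eval_tuple (homog_part e F) x *m B) 0 j.
apply/eqP; apply: (@power_sum_eq0 D a) => c.
have /rowP/(_ j) := FAB (c *: x).
rewrite !(homog_part_sum FD) mulmx_suml !summxE => /eqP; rewrite -subr_eq0 -sumrB.
move=> /eqP h; rewrite -[RHS]h; apply: eq_bigr => i _.
by rewrite -scalemxAl !eval_homog_partZ -scalemxAl mulrBr !(mxE _ _ 0 j).
Qed.

End HomogeneousComponents.

(** * Prescribed values of homogeneous equivariant maps *)

Section Span.
Variables (L : closedFieldType).

Definition power_map (q : nat) (x : L) : L := x ^+ q.

Lemma power_map_zmod q : [pchar L].-nat q -> zmod_morphism (power_map q).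
Proof.
move=> qp x y; rewrite /power_map exprDn_pchar // exprNn.
have q0 : (0 < q)%N by case/andP: qp.
(* Expanding the [q]-th power of [1 - 1] gives the sign of [(-1) ^+ q] in every characteristic,
   including 2. *)
have := exprDn_pchar 1 (-1 : L) qp; rewrite subrr expr1n expr0n -[q == 0]negbK -lt0n q0.
by move/esym/eqP; rewrite addrC addr_eq0 => /eqP->; rewrite mulN1r.
Qed.

Lemma prim_root_neq0 r (z : L) : r.-primitive_root z -> z != 0.
Proof.
move=> zr; apply: contra_eq_neq (prim_expr_order zr) => ->.
by rewrite expr0n -[r == 0]negbK -lt0n (prim_order_gt0 zr) eq_sym oner_eq0.
Qed.

Lemma power_map_monoid q : monoid_morphism (power_map q).
Proof. by split=> [|x y]; rewrite /power_map ?expr1n ?exprMn. Qed.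

Lemma mxgroup_scale n (G : seq 'M[L]_n) r (z : L) :
  mxgroup G -> r.-primitive_root z ->
  mxgroup (undup [seq z ^+ i *: g | i <- iota 0 r, g <- G]).
Proof.
move=> [_ G1 unitG mulG] zr; have r0 := prim_order_gt0 zr.
have GP h : reflect (exists i g, g \in G /\ h = z ^+ i *: g)
    (h \in undup [seq z ^+ i *: g | i <- iota 0 r, g <- G]).
  rewrite mem_undup; apply: (iffP allpairsP) => [[[i g] [_ gG ->]]|[i [g [gG ->]]]].
    by exists i, g.
  by exists (i %% r, g)%N; split=> //=; rewrite ?mem_iota ?ltn_mod ?prim_expr_mod.
split; first exact: undup_uniq.
- by apply/GP; exists 0%N, 1%:M; rewrite scale1r.
- move=> _ /GP[i [g [gG ->]]]; rewrite unitmxZ ?unitG // unitfE expf_neq0 //.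
  exact: prim_root_neq0 zr.
- move=> _ _ /GP[i [g [gG ->]]] /GP[j [h [hG ->]]]; apply/GP.
  exists (i + j)%N, (g *m h); split; first exact: mulG.
  by rewrite -scalemxAl -scalemxAr scalerA exprD.
Qed.

Variables (N : nat).
Local Notation n := N.+1.
Variable G : seq 'M[L]_n.
Hypothesis GG : mxgroup G.
Local Notation k := (size G).
Local Notation q := (k`_[pchar L])%N.
Local Notation r := (k`_[pchar L]^')%N.

Definition equivariant (F : 'I_n -> {mpoly L[n]}) :=
  {in G, forall g, forall x, eval_tuple F (x *m g) = eval_tuple F x *m g}.

Lemma equivariant_span d (v w : 'rV[L]_n) :
  (q %| d)%N -> (d == 1 %[mod r])%N -> (k ^ 5 <= d)%N -> v != 0 ->
  {in G, forall g z, v *m g = z *: v -> w *m g = z *: w} ->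
  exists F : 'I_n -> {mpoly L[n]},
    [/\ forall j, F j \is d.-homog, equivariant F & eval_tuple F v = w].
Proof.
move=> qd rd kd v0 vw; have [_ G1 unitG _] := GG.
have k0 : (0 < k)%N by case: (G) G1.
have kE : (q * r = k)%N by apply: partnC.
have q_nat : [pchar L].-nat q by apply: part_pnat.
(* In characteristic 0, [q = 1] and this Frobenius power is the identity. *)
pose s : {rmorphism L -> L} := HB.pack_for {rmorphism L -> L} (power_map q)
  (GRing.isZmodMorphism.Build L L _ (power_map_zmod q_nat))
  (GRing.isMonoidMorphism.Build L L _ (power_map_monoid q)).
have [z zr] : exists z : L, r.-primitive_root z.
  by apply: closed_prim_root; rewrite natf_neq0_pchar part_pnat.
pose G' := undup [seq z ^+ i *: g | i <- iota 0 r, g <- G].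
have GG' : mxgroup G' by apply: mxgroup_scale.
have mem_G' i g : (i < r)%N -> g \in G -> z ^+ i *: g \in G'.
  move=> ir gG; rewrite mem_undup; apply/allpairsP; exists (i, g).
  by rewrite mem_iota.
have subG' g : g \in G -> g \in G'.
  by move=> gG; rewrite -[g]scale1r -(expr0 z) mem_G' // part_gt0.
have z0 := prim_root_neq0 zr.
have stab' : {in G', forall g, v *m g = v -> w *m g = w}.
  move=> g; rewrite mem_undup => /allpairsP[[i h] /= [_ hG ->]].
  (* If [z ^+ i *: h] fixes [v], then [h] scales [v] by the inverse of [z ^+ i], and by [vw] it
     scales [w] likewise. *)
  rewrite -!scalemxAr => e; have zi : z ^+ i != 0 by rewrite expf_neq0.
  have := vw h hG (z ^+ i)^-1; rewrite -{2}e scalerA mulVf // scale1r.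
  by move=> ->; rewrite // scalerA mulfV // scale1r.
have [F1 [F1_size F1_eq F1_v]] := equivariant_interpolation s GG' stab'.
set D := (_ ^ 2).+1 in F1_size.
pose H e := homog_part e F1.
have H_eq (e : 'I_D) g x : g \in G' ->
    eval_tuple (H e) (x *m map_mx s g) = eval_tuple (H e) x *m g.
  by move=> gG'; apply: homog_part_equivariant (F1_eq g gG') e x.
have H_mod (e : 'I_D) x : eval_tuple (H e) x != 0 -> (q * e == 1 %[mod r])%N.
  move=> Hx0; have [r1|r1] := leqP r 1.
    by have -> : r = 1%N; [apply/eqP; rewrite eqn_leq r1 part_gt0 | rewrite !modn1].
  (* The twist turns the scalar [z] into [z ^+ q], so equivariance in degree [e] reads
     [z ^+ (q * e) = z] where [H e] is nonzero. *)
  have := H_eq e (z *: 1%:M) x; rewrite -{1}(expr1 z) mem_G' // => /(_ isT).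
  rewrite map_mxZ map_mx1 -!scalemxAr !mulmx1 eval_homog_partZ => /eqP.
  rewrite -subr_eq0 -scalerBl scaler_eq0 (negbTE Hx0) orbF subr_eq0.
  by rewrite -exprM -[X in _ == X]expr1 (eq_prim_root_expr zr).
have [I [I_homog I_inv I_v]] := invariant_nonzero_at GG v0.
have deg (e : 'I_D) : (q * e == 1 %[mod r])%N ->
    (q * e + k * ((d - q * e) %/ k) = d)%N.
  move=> qe; have qed : (q * e <= d)%N.
    (* Here [q <= k], and [e] is at most the square of the size of [G'], itself at most
       [r * k <= k ^ 2]. *)
    apply: leq_trans kd; have -> : (k ^ 5 = k * (k ^ 2) ^ 2)%N by rewrite -expnM -expnS.
    apply: leq_mul; first exact: dvdn_leq (dvdn_part _ _).
    have := ltn_ord e; rewrite ltnS => /leq_trans; apply; rewrite leq_exp2r //.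
    apply: leq_trans (size_undup _) _; rewrite size_allpairs size_iota.
    by rewrite -mulnn leq_mul2r (dvdn_leq k0 (dvdn_part _ _)) orbT.
  rewrite [X in (_ + X)%N]mulnC divnK ?subnKC //.
  (* Both [d] and [q * e] are 0 modulo [q] and 1 modulo [r]. *)
  rewrite -[X in (X %| _)%N]kE Gauss_dvd ?coprime_partC //.
  rewrite dvdn_sub ?dvdn_mulr //= -eqn_mod_dvd //.
  by rewrite (eqP rd) eq_sym.
pose a (e : 'I_D) := ((d - q * e) %/ k)%N.
pose Frob := [tuple 'X_i ^+ q | i < n] : n.-tuple {mpoly L[n]}.
have FrobE (p : {mpoly L[n]}) (x : 'rV[L]_n) : (p \mPo Frob).@[x 0] = p.@[(map_mx s x) 0].
  rewrite comp_mpoly_meval; apply: meval_eq => i.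
  by rewrite tnth_mktuple rmorphXn /= mevalXU mxE.
(* Powers of the invariant [I] bring all components to degree [d]; dividing by its value at [v]
   leaves the value at [v] unchanged. *)
pose F j := \sum_(e < D | (q * e == 1 %[mod r])%N)
  (I.@[v 0] ^+ a e)^-1 *: ((H e j \mPo Frob) * I ^+ a e).
have FE x : eval_tuple F x = \sum_(e < D | (q * e == 1 %[mod r])%N)
    ((I.@[v 0] ^+ a e)^-1 * I.@[x 0] ^+ a e) *: eval_tuple (H e) (map_mx s x).
  apply/rowP => j; rewrite summxE mxE raddf_sum; apply: eq_bigr => e _ /=.
  rewrite mevalZ mevalM rmorphXn FrobE !mxE -mulrA; congr (_ * _).
  by rewrite mulrC.
exists F; split.
- move=> j; apply: rpred_sum => e qe; apply: rpredZ; rewrite -(deg e qe).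
  apply: dhomogM; last exact: dhomogMn.
  apply: dhomog_comp => [|i]; first exact: pihomogP.
  by rewrite tnth_mktuple -[q in q.-homog]mul1n; apply: dhomogMn; rewrite dhomogX /= mdeg1.
- move=> g gG x; rewrite !FE mulmx_suml; apply: eq_bigr => e _.
  by rewrite I_inv // map_mxM H_eq ?subG' // scalemxAl.
- rewrite FE -[RHS]F1_v (homog_part_sum F1_size) [RHS](bigID (fun e : 'I_D => q * e == 1 %[mod r])%N) /=.
  rewrite [X in _ = _ + X]big1 ?addr0 => [|e]; last first.
    by apply: contraNeq => /H_mod.
  by apply: eq_bigr => e _; rewrite mulVf ?scale1r // expf_neq0.
Qed.

End Span.

(** * Equivariant maps without zeros *)

(** A family in [E] of maximal rank spans [E], since a further member outside its span would raise
    the rank. *)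
Lemma spanning_rows (L : fieldType) (a : nat) (E : 'rV[L]_a -> Prop) :
  exists (m : nat) (M : 'M[L]_(m, a)),
    (forall i, E (row i M)) /\ (forall c, E c -> (c <= M)%MS).
Proof.
pose R r := `[< exists m (M : 'M[L]_(m, a)), (forall i, E (row i M)) /\ \rank M = r >].
have R0 : exists r, R r.
  by exists 0%N; apply/asboolP; exists 0%N, 0; split=> [[]//|]; rewrite mxrank0.
have Ra r : R r -> (r <= a)%N.
  by move=> /asboolP[m [M [_ <-]]]; apply: rank_leq_col.
case: (ex_maxnP R0 Ra) => r /asboolP[m [M [ME Mr]]] rmax.
exists m, M; split=> // c Ec; apply: contraT => cM.
have /rmax : R (\rank (col_mx M c)).
  apply/asboolP; exists (m + 1)%N, (col_mx M c); split=> // i.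
  rewrite -[i]splitK; case: (split i) => j; first by rewrite rowKu.
  by rewrite rowKd (ord1 j) row_id.
have Mc : (M <= col_mx M c)%MS by rewrite -addsmxE addsmxSl.
by rewrite -Mr (geq_leqif (mxrank_leqif_sup Mc)) col_mx_sub (negbTE cM) andbF.
Qed.

Section Generic.
Variables (L : closedFieldType) (N : nat).
Local Notation n := N.+1.
Variable G : seq 'M[L]_n.
Hypothesis GG : mxgroup G.
Local Notation k := (size G).

Definition joint_eigenspace (S : seq ('M[L]_n * L)) : 'M[L]_n :=
  foldr (fun p W => (eigenspace p.1 p.2 :&: W)%MS) 1%:M S.

Lemma joint_eigenspaceP S (x : 'rV[L]_n) :
  reflect {in S, forall p, x *m p.1 = p.2 *: x} (x <= joint_eigenspace S)%MS.
Proof.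
have -> : (x <= joint_eigenspace S)%MS = all (fun p => x <= eigenspace p.1 p.2)%MS S.
  by elim: S => [|p S IH] /=; rewrite ?submx1 // sub_capmx IH.
by apply: (iffP allP) => h p /h /eigenspaceP.
Qed.

(* A vector determines the joint eigenspace of all the pairs [(g, z)] with
   [v *m g = z *: v]; only finitely many spaces occur. *)
Lemma joint_eigenspaces :
  exists Ws : seq 'M[L]_n, forall v : 'rV[L]_n, v != 0 ->
    exists W, [/\ W \in Ws, (v <= W)%MS &
      forall w : 'rV[L]_n, (w <= W)%MS ->
        {in G, forall g z, v *m g = z *: v -> w *m g = z *: w}].
Proof.
(* Eigenvalues are roots of the characteristic polynomial, so [PL] lists all possible pairs, and bit
   masks enumerate its sublists. *)
pose spec (g : 'M[L]_n) := sval (closed_field_poly_normal (char_poly g)).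
pose PL := [seq (g, z) | g <- G, z <- spec g].
pose Ws := [seq joint_eigenspace (mask t PL) | t : (size PL).-tuple bool].
exists Ws => v v0; pose S := [seq p <- PL | v *m p.1 == p.2 *: v].
exists (joint_eigenspace S); split.
- rewrite /S filter_mask; apply/mapP.
  by exists (map_tuple (fun p => v *m p.1 == p.2 *: v) (in_tuple PL)); rewrite ?mem_enum.
- by apply/joint_eigenspaceP => p; rewrite mem_filter => /andP[/eqP].
- move=> w /joint_eigenspaceP wS g gG z vg; apply: (wS (g, z)).
  rewrite mem_filter /= vg eqxx; apply/allpairsPdep; exists g, z; split=> //.
  rewrite /spec; case: closed_field_poly_normal => rs /= e.
  have : root (char_poly g) z by rewrite -eigenvalue_root_char; apply/eigenvalueP; exists v.
  by rewrite e rootZ ?root_prod_XsubC // lead_coef_eq0 monic_neq0 ?char_poly_monic.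
Qed.

(** Encoding polynomial tuples by coefficient row vectors puts the equivariant maps of degree [d] in
    a space to which [spanning_rows] applies. *)
Definition coef_tuple d (c : 'rV[L]_#|{: 'I_n * 'X_{1..n < d.+1}}|) (j : 'I_n) :
  {mpoly L[n]} := \sum_b c 0 (enum_rank (j, b)) *: 'X_[bmnm b].

Lemma coef_tuple_comb d m (u : 'rV[L]_m) (M : 'M[L]_(m, _)) j :
  @coef_tuple d (u *m M) j = \sum_i u 0 i *: coef_tuple (row i M) j.
Proof.
under [RHS]eq_bigr do rewrite scaler_sumr.
rewrite exchange_big; apply: eq_bigr => b _ /=.
rewrite mxE scaler_suml; apply: eq_bigr => i _.
by rewrite mxE scalerA.
Qed.

Lemma homog_coef_tuple d (F : 'I_n -> {mpoly L[n]}) :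
  (forall j, F j \is d.-homog) -> exists c, F =1 @coef_tuple d c.
Proof.
move=> hF.
pose cf (p : 'I_n * 'X_{1..n < d.+1}) := (F p.1)@_(bmnm p.2).
exists (\row_i cf (enum_val i)) => j.
rewrite {1}(@mpolywE _ _ d.+1 (F j)).
  by apply: eq_bigr => b _; rewrite mxE enum_rankK.
rewrite msizeE; apply/bigmax_leqP_seq => b bF _.
by rewrite (dhomog_mf (hF j) bF).
Qed.

(** Take a finite spanning family of the equivariant maps of degree [d]. By [equivariant_span] its
    values at [v] span a space containing the joint eigenspace attached to [v], as [generic_member]
    requires. *)
Lemma equivariant_nonvanishing d :
  (k`_[pchar L] %| d)%N -> (d == 1 %[mod k`_[pchar L]^'])%N -> (k ^ 5 <= d)%N ->
  exists F : 'I_n -> {mpoly L[n]}, [/\ forall j, F j \is d.-homog,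
    equivariant G F & forall v, v != 0 -> eval_tuple F v != 0].
Proof.
move=> qd rd kd.
pose E c := (forall j, @coef_tuple d c j \is d.-homog) /\ equivariant G (coef_tuple c).
have [m [M [ME Mspan]]] := spanning_rows E.
pose F (i : 'I_m) := coef_tuple (row i M).
have combE (u : 'rV_m) x :
    eval_tuple (coef_tuple (u *m M)) x = u *m eval_family F x.
  apply/rowP => j; rewrite !mxE coef_tuple_comb raddf_sum.
  by apply: eq_bigr => i _; rewrite /= mevalZ mxE.
have [Ws coverWs] := joint_eigenspaces.
have [t tP] : exists t : 'rV_m, forall v, v != 0 -> t *m eval_family F v != 0.
  apply: (@generic_member L n m d F _ Ws) => [i j|v v0]; first exact: (ME i).1.
  have [W [WWs vW WP]] := coverWs v v0; exists W => //; rewrite vW.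
  apply/row_subP => i.
  have [H [Hd Heq <-]] :=
    equivariant_span GG qd rd kd v0 (WP _ (row_sub i W)).
  have [c Hc] := homog_coef_tuple Hd.
  have Hce x : eval_tuple H x = eval_tuple (coef_tuple c) x.
    by apply/rowP => j; rewrite !mxE Hc.
  have /Mspan/submxP[u cu] : E c.
    by split=> [j|g gG x]; [rewrite -Hc | rewrite -!Hce Heq].
  by rewrite Hce cu combE submxMl.
exists (coef_tuple (t *m M)); split.
- move=> j; rewrite coef_tuple_comb; apply: rpred_sum => i _.
  by apply: rpredZ; apply: (ME i).1.
- move=> g gG x; rewrite !combE -mulmxA; congr (_ *m _).
  apply/row_matrixP => i; rewrite row_mul.
  have rowE y : row i (eval_family F y) = eval_tuple (F i) y.
    by apply/rowP => j; rewrite !mxE.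
  by rewrite !rowE (ME i).2.
- by move=> v v0; rewrite combE tP.
Qed.

End Generic.

(** * Finite subgroups of PGL *)

Section Lift.
Variables (K : fieldType) (L : closedFieldType) (iota : {rmorphism K -> L}) (N : nat).
Local Notation n := N.+1.
Variable Gamma : set (PGL K n).
Hypothesis Gamma_finite : finite_set Gamma.
Hypothesis Gamma1 : Gamma 1%g.
Hypothesis GammaM : forall a b, Gamma a -> Gamma b -> Gamma (a * b)%g.

Local Open Scope classical_set_scope.

(** Transposed because [GL] acts on columns while equivariance is stated for rows; this reverses the
    product in [repr_mxM]. *)
Definition repr_mx (a : PGL K n) : 'M[L]_n := (map_mx iota (GLmx (repr a)))^T.

Lemma repr_mx_unit a : repr_mx a \in unitmx.
Proof. by rewrite unitmx_tr map_unitmx GLmxP. Qed.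

Lemma repr_mx1 : exists c, 1%:M = c *: repr_mx 1%g.
Proof.
have /GLscal_eqP[c e] := GLscal_eq_imp (GLscal_repr (GL1 K n)).
by exists (iota c); rewrite /repr_mx -linearZ /= -map_mxZ -e map_mx1 trmx1.
Qed.

Lemma repr_mxM a b : exists c, repr_mx a *m repr_mx b = c *: repr_mx (b * a)%g.
Proof.
have /GLscal_eqP[c e] := GLscal_eq_imp (GLscal_repr (GLM (repr b) (repr a))).
by exists (iota c); rewrite /repr_mx -trmx_mul -map_mxM -linearZ /= -map_mxZ -e.
Qed.

(* The matrices of determinant [1] representing the elements of [Gamma]. *)
Lemma lift_to_mxgroup :
  exists2 G : seq 'M[L]_n, mxgroup G &
    forall a, Gamma a -> exists2 c, c != 0 & c *: repr_mx a \in G.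
Proof.
have [s sE] := (finite_seqP _).1 Gamma_finite.
have sP a : Gamma a <-> a \in s by rewrite sE.
pose rts (a : PGL K n) :=
  sval (closed_field_poly_normal ('X^n - (\det (repr_mx a))^-1%:P)).
have det0 a : \det (repr_mx a) != 0.
  by rewrite -unitfE -unitmxE repr_mx_unit.
have rtsP a c : (c \in rts a) = (\det (c *: repr_mx a) == 1).
  rewrite /rts; case: closed_field_poly_normal => rs /= e.
  rewrite -root_prod_XsubC; have := e.
  rewrite (monicP (monicXnsubC _ _)) // scale1r => <-.
  rewrite rootE !hornerE detZ subr_eq0.
  by rewrite -(inj_eq (mulIf (det0 a))) mulVf.
pose G := undup [seq c *: repr_mx a | a <- s, c <- rts a].
have GP B : reflect (\det B = 1 /\ exists a c, Gamma a /\ B = c *: repr_mx a) (B \in G).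
  rewrite mem_undup; apply: (iffP allpairsPdep) => [[a [c [sa ca ->]]]|].
    by split; [apply/eqP; rewrite -rtsP | exists a, c; rewrite sP].
  move=> [B1 [a [c [Ga BE]]]]; exists a, c; split=> //; first exact/sP.
  by rewrite rtsP -BE B1.
exists G.
  split; first exact: undup_uniq.
  - apply/GP; rewrite det1; split=> //; have [c e] := repr_mx1.
    by exists 1%g, c; split=> //; apply: Gamma1.
  - by move=> B /GP[B1 _]; rewrite unitmxE B1 unitr1.
  - move=> B C /GP[B1 [a [c [Ga BE]]]] /GP[C1 [b [e [Gb CE]]]]; apply/GP.
    rewrite det_mulmx B1 C1 mulr1; split=> //; have [f abE] := repr_mxM a b.
    exists (b * a)%g, (c * e * f); split; first exact: GammaM.
    by rewrite BE CE -scalemxAl -scalemxAr abE !scalerA.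
move=> a Ga.
have /closed_rootP[c] : size ('X^n - (\det (repr_mx a))^-1%:P) != 1%N.
  by rewrite size_XnsubC.
rewrite rootE !hornerE subr_eq0 => /eqP ce.
have cdet : \det (c *: repr_mx a) = 1 by rewrite detZ ce mulVf.
exists c; last by apply/GP; split=> //; exists a, c.
by apply: contra_eq_neq ce => ->; rewrite expr0n /= eq_sym invr_eq0.
Qed.

End Lift.

(** * From equivariant maps to morphisms of projective space *)

Section EquivariantMorphism.
Variables (L : closedFieldType) (N : nat).
Local Notation n := N.+1.

Lemma linear_tupleE (A : 'M[L]_n) (x : 'rV[L]_n) i :
  (tnth (linear_tuple A) i).@[x 0] = (x *m A^T) 0 i.
Proof.
rewrite tnth_mktuple raddf_sum mxE; apply: eq_bigr => j _.
by rewrite /= mevalZ mevalXU mxE mulrC.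
Qed.

Lemma mtuple_nonvanishing d (F : 'I_n -> {mpoly L[n]}) :
  (forall j, F j \is d.-homog) -> (forall v, v != 0 -> eval_tuple F v != 0) ->
  `[< is_morphism_tuple [tuple F j | j < n] >].
Proof.
move=> Fd Fnz; apply/asboolP; split; first by exists d => i; rewrite tnth_mktuple.
move=> v [i vi]; have : eval_tuple F (\row_j v j) != 0.
  by apply: Fnz; apply: contra_neq vi => /rowP/(_ i); rewrite !mxE.
move=> nz; apply: contrapT => /forallNP h; case/eqP: nz; apply/rowP => j.
rewrite !mxE; have /negP := h j; rewrite negbK tnth_mktuple => /eqP e.
by rewrite -[RHS]e; apply: meval_eq => l; rewrite mxE.
Qed.

(** By homogeneity, commuting with [c *: A^T] means that conjugation by [A] multiplies [F] by
    [c ^+ d / c], which does not change the projective class. *)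
Lemma commute_projAut d (A : GL L n) (F : 'I_n -> {mpoly L[n]}) (M : morphism_tuple L N) c :
  (forall j, F j \is d.-homog) -> (forall j, tnth M j = F j) -> c != 0 ->
  (forall x, eval_tuple F (x *m (c *: A^T)) = eval_tuple F x *m (c *: A^T)) ->
  projAut (\pi_(projEnd L N) M) (\pi_(PGL L n) A).
Proof.
move=> Fd MF c0 Feq; rewrite /projAut /=.
have -> : ((\pi_(PGL L n) A)^-1)%g = \pi_(PGL L n) (GLV A) by exact: PGLV_pi.
rewrite !End_of_PGL_pi !End_comp_pi; apply/eq_piEnd.
exists (c ^+ d / c); first by rewrite mulf_neq0 ?invr_eq0 ?expf_neq0.
move=> i; apply: mpoly_ext => x.
have AU : A^T \in unitmx by rewrite unitmx_tr GLmxP.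
have evF (y : 'rV[L]_n) j : (tnth M j).@[y 0] = eval_tuple F y 0 j.
  by rewrite MF mxE.
pose y := x *m invmx A^T.
rewrite mevalZ evF.
transitivity ((eval_tuple F y *m A^T) 0 i).
  rewrite [tnth _ i]tnth_mktuple comp_mpoly_meval [tnth _ i]tnth_mktuple.
  rewrite comp_mpoly_meval -linear_tupleE; apply: meval_eq => j.
  rewrite -evF; apply: meval_eq => l.
  by rewrite linear_tupleE /= trmx_inv.
have yE : y *m (c *: A^T) = c *: x by rewrite -scalemxAr mulmxKV.
have FyE : eval_tuple F y *m (c *: A^T) = c ^+ d *: eval_tuple F x.
  by rewrite -Feq yE; apply/rowP => j; rewrite !mxE (meval_homogZ _ _ (Fd j)).
have -> : eval_tuple F y *m A^T = c^-1 *: (eval_tuple F y *m (c *: A^T)).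
  by rewrite -scalemxAr scalerA mulVf // scale1r.
by rewrite FyE scalerA [LHS]mxE mulrC [c^-1 * _]mulrC mulrC.
Qed.

(** This tells the constructed morphisms apart. The absence of common zeros provides a nonzero
    component, whose degree is unique. *)
Lemma mtuple_class_degree d e (F G : morphism_tuple L N) :
  (forall i, tnth F i \is d.-homog) -> (forall i, tnth G i \is e.-homog) ->
  \pi_(projEnd L N) F = \pi_(projEnd L N) G -> d = e.
Proof.
move=> Fd Ge /eq_piEnd[c c0 FG]; have [_ nz] := mtupleP F.
have [j Fj] : exists j, (tnth F j).@[fun=> 1] != 0.
  by apply: nz; exists ord0; rewrite oner_eq0.
apply: (@dhomog_uniq _ _ mdeg (tnth F j)) => //.
  by apply: contraNneq Fj => ->; rewrite meval0.
by rewrite FG; apply: rpredZ.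
Qed.

Lemma equivariant_morphisms (G : seq 'M[L]_n) : mxgroup G ->
  exists2 deg : nat -> nat, injective deg & forall i,
    exists2 F : 'I_n -> {mpoly L[n]}, equivariant G F &
      exists2 M : morphism_tuple L N, (forall j, tnth M j = F j)
        & forall j, F j \is (deg i).-homog.
Proof.
move=> GG; set k := size G; set q := (k`_[pchar L])%N; set r := (k`_[pchar L]^')%N.
have k0 : (0 < k)%N by have [_ G1 _ _] := GG; rewrite /k; case: (G) G1.
have co : coprime q r by apply: coprime_partC.
(* The Chinese remainder gives 0 modulo [q] and 1 modulo [r]; multiples of [k = q * r] keep both
   residues, and [k ^ 5] ensures the lower bound. *)
pose deg i := (chinese q r 0 1 + k * (k ^ 5 + i))%N.
exists deg => [i j /addnI/eqP|i].
  by rewrite eqn_pmul2l // eqn_add2l => /eqP.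
have [|||F [Fd Feq Fnz]] := @equivariant_nonvanishing L N G GG (deg i).
- rewrite dvdn_add //; last by rewrite dvdn_mulr ?dvdn_part.
  by rewrite /dvdn chinese_modl // mod0n.
- have /eqP kr : (r %| k)%N by apply: dvdn_part.
  by rewrite -modnDmr -modnMml kr mul0n mod0n addn0 chinese_modr.
- apply: leq_trans (leq_addl _ _); apply: leq_trans (leq_pmull _ k0).
  exact: leq_addr.
exists F => //; exists (MkMorphismTuple (mtuple_nonvanishing Fd Fnz)) => // j.
by rewrite tnth_mktuple.
Qed.

End EquivariantMorphism.

Section Infinite.
Variables (K : fieldType) (L : closedFieldType) (iota : {rmorphism K -> L}) (N : nat).
Local Notation n := N.+1.
Variable Gamma : set (PGL K n).
Hypothesis Gamma_finite : finite_set Gamma.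
Hypothesis Gamma1 : Gamma 1%g.
Hypothesis GammaM : forall a b, Gamma a -> Gamma b -> Gamma (a * b)%g.

Local Open Scope classical_set_scope.

Lemma infinite_projAut :
  infinite_set [set f : projEnd L N | PGLmap iota @` Gamma `<=` projAut f].
Proof.
have [G GG GammaG] := lift_to_mxgroup iota Gamma_finite Gamma1 GammaM.
have [deg deg_inj degP] := equivariant_morphisms GG.
set S := [set f | _].
have /choice[M MP] : forall i, exists M : morphism_tuple L N,
    S (\pi_(projEnd L N) M) /\ forall j, tnth M j \is (deg i).-homog.
  move=> i; have [F Feq [M MF Fd]] := degP i; exists M; split; last by move=> j; rewrite MF.
  move=> _ [a Ga <-]; have [c c0 cG] := GammaG a Ga.
  by apply: (commute_projAut Fd MF c0) => x; apply: Feq.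
(* Distinct degrees make the sequence of classes injective, so a finite [S] would have a finite
   preimage, which is all of [nat]. *)
move=> Sfin; apply: infinite_nat.
have -> : [set: nat] = (fun i => \pi_(projEnd L N) (M i)) @^-1` S.
  by apply/seteqP; split=> // i _; apply: (MP i).1.
apply: finite_preimage Sfin => i j _ _ /(mtuple_class_degree (MP i).2 (MP j).2).
exact: deg_inj.
Qed.

End Infinite.

End Equivariants.

Local Open Scope classical_set_scope.

Theorem mainTheorem3 (K : fieldType) (Kbar : closedFieldType)
    (iota : {rmorphism K -> Kbar})
    (Kbar_algebraic : forall x : Kbar, algebraicOver iota x)
    (N : nat) (Gamma : set (PGL K N.+1))
    (Gamma_group : group_closed [in Gamma]) (Gamma_finite : finite_set Gamma) :
  infinite_set [set f : projEnd Kbar N | PGLmap iota @` Gamma `<=` projAut f].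
Proof.
have [G1 GV] := Gamma_group.
have inG a : Gamma a <-> a \in [in Gamma].
  by rewrite unfold_in; split=> [/mem_set|/set_mem].
apply: Equivariants.infinite_projAut => //; first exact/inG.
move=> a b /inG Ga /inG Gb; apply/inG.
(* [GV] is closure under [a * b^-1]; using it first for the inverse of [b] yields closure under
   products. *)
have GbV := GV _ _ G1 Gb; rewrite mul1g in GbV.
by have := GV _ _ Ga GbV; rewrite invgK.
Qed.
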